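(* Let $k \in \{2,3\}$. For each $n$, let $L = L_n$ be the set of eigenvalues of the complete $k$-uniform hypergraph $K_n^{(k)}$ on $n$ vertices (that is, of its adjacency hypermatrix), and let $M = M_n$ be the set of eigenvalues of $\frac{1}{(k-1)!}\mathbb{J}_n^k$, where $\mathbb{J}_n^k$ is the all-ones hypermatrix of order $k$ and dimension $n$. Then, as $n \to \infty$, $$\delta(M_n, L_n) = o(n^{k-1}),$$ where $\delta$ denotes the Minkowski distance between subsets of $\mathbb{C}$.
   Context: A (cubical) hypermatrix of order $k$ and dimension $n$ is an array $A = [a_{i_1\cdots i_k}]$ with indices in $[n]=\{1,\ldots,n\}$. $\mathbb{J}_n^k$ is the order $k$, dimension $n$ hypermatrix all of whose entries are $1$. The adjacency hypermatrix of a $k$-uniform hypergraph $H$ on vertex set $[n]$ with edge set $E(H)$ is the order $k$, dimension $n$ hypermatrix whose $(i_1,\ldots,i_k)$ entry is $\frac{1}{(k-1)!}$ if $\{i_1,\ldots,i_k\}\in E(H)$ and $0$ otherwise (in particular it is $0$ whenever some index is repeated). The complete $k$-uniform hypergraph $K_n^{(k)}$ has as edges all $k$-element subsets of $[n]$. For a symmetric hypermatrix $A$ (entries invariant under permutation of the indices) of order $k$ and dimension $n$, a complex number $\lambda$ is an eigenvalue of $A$ if there is a nonzero $\mathbf{v}\in\mathbb{C}^n$ such that, for every $i\in[n]$, $$\sum_{i_2,\ldots,i_k=1}^n a_{i i_2\cdots i_k}v_{i_2}\cdots v_{i_k} = \lambda v_i^{k-1}.$$ For $A,B\subset\mathbb{C}$,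 the Minkowski distance is $\delta(A,B)=\inf\{r : A\subset\mathcal{N}_r(B)\text{ and }B\subset\mathcal{N}_r(A)\}$, where $\mathcal{N}_r(S)=\bigcup_{z\in S}B_r(z)$ and $B_r(z)=\{w\in\mathbb{C}: |z-w|<r\}$. *)

(* Defs.v *)
From HB Require Import structures.
From mathcomp Require Import all_boot all_order all_algebra.
From mathcomp Require Import all_classical all_reals all_analysis.
From mathcomp Require Import complex.

Set Implicit Arguments.
Unset Strict Implicit.
Unset Printing Implicit Defensive.

Import Order.TTheory GRing.Theory Num.Theory.
Import numFieldNormedType.Exports.

Local Open Scope ring_scope.
Local Open Scope complex_scope.

Definition hypermatrix (K : Type) (k n : nat) := {ffun k.-tuple 'I_n -> K}.

Definition all_ones (K : fieldType) (k n : nat) : hypermatrix K k n :=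
  [ffun _ => 1].

Definition scale_hypermatrix (K : fieldType) (k n : nat) (c : K)
    (A : hypermatrix K k n) : hypermatrix K k n :=
  [ffun t => c * A t].

Record uniform_hypergraph (k n : nat) := UniformHypergraph {
  edges : {set {set 'I_n}};
  edges_uniform : forall e, e \in edges -> #|e| = k }.

Definition adjacency (K : fieldType) (k n : nat) (H : uniform_hypergraph k n) :
    hypermatrix K k n :=
  [ffun t : k.-tuple 'I_n =>
     if [set i in t]%SET \in edges H then ((k.-1)`!)%:R^-1 else 0].

Definition complete_edges (k n : nat) : {set {set 'I_n}} :=
  [set e : {set 'I_n} | #|e| == k]%SET.

Lemma complete_edges_uniform (k n : nat) (e : {set 'I_n}) :
  e \in complete_edges k n -> #|e| = k.
Proof. by rewrite inE => /eqP. Qed.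

Definition complete_hypergraph (k n : nat) : uniform_hypergraph k n :=
  UniformHypergraph (@complete_edges_uniform k n).

(* The index tuple (i_1, ..., i_k) of the entry ranges over the tuples with
   i_1 = i, and the monomial is taken over the remaining k - 1 indices. *)
Definition hyper_eigenvalue (K : fieldType) (k n : nat)
    (A : hypermatrix K k n) (lambda : K) : Prop :=
  exists v : 'rV[K]_n, v != 0 /\
    forall i : 'I_n,
      \sum_(t : k.-tuple 'I_n | ohead t == Some i)
         A t * \prod_(j <- behead t) v 0 j
      = lambda * v 0 i ^+ k.-1.

Local Open Scope classical_set_scope.

Definition hyper_spectrum (K : fieldType) (k n : nat)
    (A : hypermatrix K k n) : set K :=
  [set lambda | hyper_eigenvalue A lambda].

(* In the partial order of R[i], x < r%:C says that x is real and less than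
   r; norms are real elements of R[i]. *)
Definition cdisk (R : realType) (z : R[i]) (r : R) : set R[i] :=
  [set w | `|z - w| < r%:C].

Definition thickening (R : realType) (r : R) (S : set R[i]) : set R[i] :=
  \bigcup_(z in S) cdisk z r.

(* The infimum is extended-real, so that it is +oo when no r is admissible. *)
Definition minkowski_dist (R : realType) (A B : set R[i]) : \bar R :=
  ereal_inf [set r%:E | r in
    [set r : R | A `<=` thickening r B /\ B `<=` thickening r A]].

Definition complete_spectrum (R : realType) (k n : nat) : set R[i] :=
  hyper_spectrum (adjacency R[i] (complete_hypergraph k n)).

Definition all_ones_spectrum (R : realType) (k n : nat) : set R[i] :=
  hyper_spectrum (scale_hypermatrix ((k.-1)`!)%:R^-1 (all_ones R[i] k n)).

Arguments complete_spectrum : clear implicits.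
Arguments all_ones_spectrum : clear implicits.

(* Main.v *)
(** For k = 2 the two adjacency matrices differ by the identity, so the spectra
    are translates of each other by 1.

    For k = 3, put S = sum v_j and Q = sum v_j ^ 2. The eigenvalues of J / 2 are
    0 and the numbers (p - q)^2 / 2 with p + q = n. The eigenvalue equation of
    the complete hypergraph is a quadratic equation for each v_i with
    coefficients depending on S and Q only; hence v takes at most two values a
    and b, with multiplicities p and q, and eliminating a and b shows that
    m = lambda - 1 is a root of
      m^3 - d m^2 + 3 p q m + p q n / 2,   where d = ((p - q)^2 - 3 n) / 2.
    On the scale n^2 the two last terms are negligible, so every root is close
    to 0 or to d; conversely the product of the distances from d to the three
    roots is |3 p q d + p q n / 2| = O(n^4) = o(n^6), so some root is close
    to d. *)
Require Import Defs.
From HB Require Import structures.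
From mathcomp Require Import all_boot all_order all_algebra.
From mathcomp Require Import all_classical all_reals all_analysis.
From mathcomp Require Import complex ring lra.

Import Order.TTheory GRing.Theory Num.Theory.
Import numFieldNormedType.Exports.

Local Open Scope ring_scope.

(** * Sums over tuples, split along the first index *)

Section TupleSums.
Variables (V : nmodType) (I : finType).

Lemma big_tuple_head (k : nat) (i : I) (F : k.+1.-tuple I -> V) :
  \sum_(t : k.+1.-tuple I | ohead t == Some i) F t
  = \sum_(t : k.-tuple I) F (cons_tuple i t).
Proof.
rewrite (reindex_onto (cons_tuple i) (@behead_tuple _ _)) /=.
  apply: eq_bigl => t; rewrite eqxx /=.
  by apply/eqP/val_inj.
move=> t; case/tupleP: t => j t /= /eqP [->].
exact/val_inj.
Qed.

Lemma big_tuple_cons (k : nat) (F : k.+1.-tuple I -> V) :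
  \sum_(t : k.+1.-tuple I) F t
  = \sum_i \sum_(t : k.-tuple I) F (cons_tuple i t).
Proof.
rewrite (partition_big (@thead _ _) predT) //=.
apply: eq_bigr => i _; rewrite -big_tuple_head.
by apply: eq_bigl => t; case/tupleP: t => j t; rewrite theadE.
Qed.

Lemma big_tuple_nil (F : 0.-tuple I -> V) :
  \sum_(t : 0.-tuple I) F t = F [tuple].
Proof. by rewrite (big_pred1 [tuple]) // => t; apply/esym/eqP; exact: tuple0. Qed.

End TupleSums.

(** * The eigenvalue equations for orders 2 and 3 in terms of power sums of the vector *)

Section Eigen.
Variable K : numFieldType.

(** A [k]-tuple has a set of [k] entries exactly when its entries are distinct. *)
Lemma adjacency_completeE (k n : nat) (t : k.-tuple 'I_n) :
  adjacency K (complete_hypergraph k n) t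
  = if uniq t then ((k.-1)`!)%:R^-1 else 0.
Proof.
rewrite ffunE inE cardsE -[in X in _ == X](size_tuple t).
by rewrite -(sameP card_uniqP eqP).
Qed.

Lemma all_ones_eigen2 (n : nat) (l : K) :
  hyper_eigenvalue (scale_hypermatrix (1`!)%:R^-1 (all_ones K 2 n)) l
  <-> exists v : 'rV[K]_n, v != 0 /\ forall i, \sum_j v 0 j = l * v 0 i.
Proof.
have E (v : 'rV[K]_n) i : \sum_(t : 2.-tuple 'I_n | ohead t == Some i)
    scale_hypermatrix (1`!)%:R^-1 (all_ones K 2 n) t
      * \prod_(j <- behead t) v 0 j = \sum_j v 0 j.
  rewrite big_tuple_head big_tuple_cons; apply: eq_bigr => j _.
  by rewrite big_tuple_nil !ffunE /= big_seq1 invr1 !mul1r.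
by split=> -[v [v0 vE]]; exists v; split=> // i; move: (vE i); rewrite E.
Qed.

Lemma complete_eigen2 (n : nat) (l : K) :
  hyper_eigenvalue (adjacency K (complete_hypergraph 2 n)) l
  <-> exists v : 'rV[K]_n, v != 0 /\
        forall i, \sum_j v 0 j - v 0 i = l * v 0 i.
Proof.
have E (v : 'rV[K]_n) i : \sum_(t : 2.-tuple 'I_n | ohead t == Some i)
    adjacency K (complete_hypergraph 2 n) t * \prod_(j <- behead t) v 0 j
    = \sum_j v 0 j - v 0 i.
  rewrite big_tuple_head big_tuple_cons (bigD1 i) //=.
  rewrite [in RHS](bigD1 i) //= addrAC subrr add0r.
  rewrite big_tuple_nil adjacency_completeE /= inE eqxx mul0r add0r.
  apply: eq_bigr => j ji; rewrite big_tuple_nil adjacency_completeE /= inE.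
  by rewrite eq_sym ji big_seq1 invr1 mul1r.
by split=> -[v [v0 vE]]; exists v; split=> // i; move: (vE i); rewrite E.
Qed.

Lemma all_ones_eigen3 (n : nat) (l : K) :
  hyper_eigenvalue (scale_hypermatrix (2`!)%:R^-1 (all_ones K 3 n)) l
  <-> exists v : 'rV[K]_n, v != 0 /\
        forall i, (\sum_j v 0 j) ^+ 2 / 2 = l * v 0 i ^+ 2.
Proof.
have E (v : 'rV[K]_n) i : \sum_(t : 3.-tuple 'I_n | ohead t == Some i)
    scale_hypermatrix (2`!)%:R^-1 (all_ones K 3 n) t
      * \prod_(j <- behead t) v 0 j = (\sum_j v 0 j) ^+ 2 / 2.
  rewrite big_tuple_head big_tuple_cons expr2 !mulr_suml.
  apply: eq_bigr => j _; rewrite big_tuple_cons mulr_sumr mulr_suml.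
  apply: eq_bigr => m _; rewrite big_tuple_nil !ffunE /= big_cons big_seq1.
  by rewrite mulr1 mulrC.
by split=> -[v [v0 vE]]; exists v; split=> // i; move: (vE i); rewrite E.
Qed.

(** Only ordered pairs of distinct indices, both different from [i], contribute. Their sum is the
    square of the sum minus the sum of squares, each taken over the indices other than [i]. *)
Lemma complete_eigen3 (n : nat) (l : K) :
  hyper_eigenvalue (adjacency K (complete_hypergraph 3 n)) l
  <-> exists v : 'rV[K]_n, v != 0 /\
        forall i, ((\sum_j v 0 j - v 0 i) ^+ 2
                   - (\sum_j v 0 j ^+ 2 - v 0 i ^+ 2)) / 2 = l * v 0 i ^+ 2.
Proof.
have E (v : 'rV[K]_n) i : \sum_(t : 3.-tuple 'I_n | ohead t == Some i)
    adjacency K (complete_hypergraph 3 n) t * \prod_(j <- behead t) v 0 j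
    = ((\sum_j v 0 j - v 0 i) ^+ 2 - (\sum_j v 0 j ^+ 2 - v 0 i ^+ 2)) / 2.
  have D (f : 'I_n -> K) : \sum_j f j - f i = \sum_(j | j != i) f j.
    by rewrite (bigD1 i) //= addrAC subrr add0r.
  rewrite big_tuple_head big_tuple_cons (bigD1 i) //= [X in X + _]big1 ?add0r.
    rewrite !D expr2 mulr_suml -sumrB mulr_suml; apply: eq_bigr => j ji.
    (* The terms with third index [i] or [j] vanish, having a repeated index; on the right, the
       square of [v 0 j] cancels the diagonal term. *)
    rewrite big_tuple_cons (bigD1 i) //= (bigD1 j) //=.
    rewrite [in RHS](bigD1 j) //= !big_tuple_nil !adjacency_completeE /=.
    rewrite !inE !eqxx !orbT /= andbF !mul0r !add0r.
    rewrite mulrDr expr2 addrAC subrr add0r mulr_sumr mulr_suml.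
        apply: eq_bigr => m /andP[mi mj].
    rewrite big_tuple_nil adjacency_completeE /= !inE.
    rewrite ![i == _]eq_sym [j == m]eq_sym (negbTE ji) (negbTE mi) (negbTE mj).
    by rewrite big_cons big_seq1 mulrC.
  move=> t _; rewrite adjacency_completeE /= inE eqxx mul0r //.
by split=> -[v [v0 vE]]; exists v; split=> // i; move: (vE i); rewrite E.
Qed.

(** * Explicit eigenvectors, and the reduction to vectors with at most two values *)

Lemma sum_two_valued (n : nat) (a b : K) (P : {set 'I_n}) :
  \sum_i (if i \in P then a else b) = a * #|P|%:R + b * (n%:R - #|P|%:R).
Proof.
rewrite (bigID (mem P)) /= (eq_bigr (fun=> a)) => [|i ->] //.
rewrite [X in _ + X](eq_bigr (fun=> b)) => [|i /negbTE ->] //.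
have -> : n%:R - #|P|%:R = #|~: P|%:R :> K.
  by rewrite -[in n%:R](card_ord n) -(cardsC P) natrD addrAC subrr add0r.
rewrite !mulr_natr -!sumr_const; congr (_ + _).
by apply: eq_bigl => i; rewrite !inE.
Qed.

Lemma all_ones_eigen2_shift (n : nat) (l : K) :
  hyper_eigenvalue (adjacency K (complete_hypergraph 2 n)) l
  <-> hyper_eigenvalue (scale_hypermatrix (1`!)%:R^-1 (all_ones K 2 n)) (l + 1).
Proof.
rewrite complete_eigen2 all_ones_eigen2.
have E (x y : K) : x - y = l * y <-> x = (l + 1) * y.
  rewrite mulrDl mul1r; split=> [<-|->]; last by rewrite addrK.
  by rewrite subrK.
by split=> -[v [v0 vE]]; exists v; split=> // i; apply/E.
Qed.

(** Serves for vectors given by a short list and padded to length [n] by the default value 0. *)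
Lemma big_ord_nth (n : nat) (s : seq K) : (size s <= n)%N ->
  \sum_(i < n) s`_i = \sum_(x <- s) x.
Proof.
move=> sn; rewrite -(subnKC sn) big_split_ord /= (big_nth 0) big_mkord.
by rewrite [X in _ + X]big1 ?addr0 // => i _; rewrite nth_default ?leq_addr.
Qed.

Lemma all_ones_eigen2_0 (n : nat) : (1 < n)%N ->
  hyper_eigenvalue (scale_hypermatrix (1`!)%:R^-1 (all_ones K 2 n)) 0.
Proof.
move=> n1; apply/all_ones_eigen2; exists (\row_j [:: 1; -1]`_j); split.
  by apply/rV0Pn; exists (Ordinal (ltnW n1)); rewrite mxE oner_eq0.
move=> i; rewrite mul0r; under eq_bigr do rewrite mxE.
by rewrite big_ord_nth // big_cons big_seq1 subrr.
Qed.

Lemma all_ones_eigen3_0 (n : nat) : (1 < n)%N ->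
  hyper_eigenvalue (scale_hypermatrix (2`!)%:R^-1 (all_ones K 3 n)) 0.
Proof.
move=> n1; apply/all_ones_eigen3; exists (\row_j [:: 1; -1]`_j); split.
  by apply/rV0Pn; exists (Ordinal (ltnW n1)); rewrite mxE oner_eq0.
move=> i; rewrite mul0r; under eq_bigr do rewrite mxE.
by rewrite big_ord_nth // big_cons big_seq1 subrr expr0n mul0r.
Qed.

Lemma all_ones_eigen3_split (n : nat) (P : {set 'I_n}) : (0 < n)%N ->
  hyper_eigenvalue (scale_hypermatrix (2`!)%:R^-1 (all_ones K 3 n))
    ((#|P|%:R - (n%:R - #|P|%:R)) ^+ 2 / 2).
Proof.
move=> n0; apply/all_ones_eigen3.
exists (\row_j if j \in P then 1 else -1); split.
  apply/rV0Pn; exists (Ordinal n0); rewrite mxE.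
  by case: ifP; rewrite ?oppr_eq0 oner_eq0.
move=> i; under eq_bigr do rewrite mxE.
rewrite sum_two_valued mul1r mulN1r mxE.
by case: ifP; rewrite ?sqrrN expr1n mulr1.
Qed.

(** When [l] is nonzero, all entries have the same square, so each is [a] or [- a]; then the sum of
    the entries is [a] times the difference of the two multiplicities. *)
Lemma all_ones_eigen3_inv (n : nat) (l : K) :
  hyper_eigenvalue (scale_hypermatrix (2`!)%:R^-1 (all_ones K 3 n)) l ->
  l = 0 \/
  exists P : {set 'I_n}, l = (#|P|%:R - (n%:R - #|P|%:R)) ^+ 2 / 2.
Proof.
move=> /all_ones_eigen3[v [v0 vE]].
have [->|l0] := eqVneq l 0; [by left | right].
have /rV0Pn[i0 vi0] := v0.
pose a := v 0 i0; pose P := [set i | v 0 i == a]; exists P.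
have vP i : v 0 i = if i \in P then a else - a.
  rewrite inE; case: eqP => // /eqP va.
  have /eqP : v 0 i ^+ 2 = a ^+ 2 by apply: (mulfI l0); rewrite -!vE.
  by rewrite eqf_sqr (negbTE va) => /eqP.
have := vE i0; under eq_bigr do rewrite vP.
rewrite sum_two_valued -/a => E.
have a20 : a ^+ 2 != 0 by rewrite expf_neq0.
by apply: (mulIf a20); rewrite -E; ring.
Qed.

(** Lies 3 (p + q) / 2 below the eigenvalue (p - q)^2 / 2 of J / 2, a gap of order n only. *)
Definition split_center (p q : K) : K := ((p - q) ^+ 2 - 3 * (p + q)) / 2.

Definition split_cubic (p q m : K) : K :=
  m ^+ 3 - split_center p q * m ^+ 2 + 3 * p * q * m + p * q * (p + q) / 2.

Lemma complete_eigen3_inv (n : nat) (l : K) :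
  hyper_eigenvalue (adjacency K (complete_hypergraph 3 n)) l ->
  l = 1 \/
  exists P : {set 'I_n}, split_cubic #|P|%:R (n%:R - #|P|%:R) (l - 1) = 0.
Proof.
move=> /complete_eigen3[v [v0 vE]].
have [->|l1] := eqVneq l 1; [by left | right].
have /rV0Pn[i0 vi0] := v0.
pose m := l - 1.
have m0 : m != 0 by rewrite subr_eq0.
have lE : l = m + 1 by rewrite subrK.
pose S := \sum_j v 0 j; pose Q := \sum_j v 0 j ^+ 2.
(* Every entry x satisfies m x^2 + S x = (S^2 - Q) / 2, a genuine quadratic since [m] is nonzero.
   The roots sum to - S / m, so [b] is the root other than [a]. If [b] equals [a] or is not
   attained, [P] is everything. *)
pose a := v 0 i0; pose b := - S / m - a.
pose P := [set i | v 0 i == a]; exists P; rewrite -/m.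
have vP i : v 0 i = if i \in P then a else b.
  rewrite inE; case: eqP => // /eqP va.
  have := vE i0; have := vE i; rewrite -/S -/Q -/a lE.
  move: (v 0 i) va => x xa Ex Ea.
  have /eqP : (x - a) * (m * (x - b)) = 0.
    transitivity ((((S - a) ^+ 2 - (Q - a ^+ 2)) / 2 - (m + 1) * a ^+ 2)
                  - (((S - x) ^+ 2 - (Q - x ^+ 2)) / 2 - (m + 1) * x ^+ 2)).
      by rewrite /b; field.
    by rewrite Ex Ea; ring.
  by rewrite !mulf_eq0 subr_eq0 (negbTE xa) (negbTE m0) subr_eq0 => /eqP.
pose p : K := #|P|%:R; pose q : K := n%:R - p.
have SE : S = a * p + b * q.
  by rewrite -sum_two_valued; apply: eq_bigr => i _; rewrite vP.
have QE : Q = a ^+ 2 * p + b ^+ 2 * q.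
  rewrite -sum_two_valued; apply: eq_bigr => i _; rewrite vP.
  by case: ifP.
(* The sum of the roots, with [S] expressed through [a] and [b]. *)
have uw : (m + p) * a + (m + q) * b = 0.
  transitivity (m * (a + b) + S); first by rewrite SE; ring.
  by rewrite /b; field.
(* The product of the roots. *)
have G0 : (S ^+ 2 - Q) / 2 + m * a * b = 0.
  transitivity (((S - a) ^+ 2 - (Q - a ^+ 2)) / 2 - (m + 1) * a ^+ 2).
    by rewrite /b; field.
  by have := vE i0; rewrite -/S -/Q -/a lE => ->; rewrite subrr.
have a20 : a ^+ 2 != 0 by rewrite expf_neq0.
apply: (mulfI a20); rewrite mulr0 -/p -/q.
(* Eliminates [b] from the relation [G0] by means of the linear relation [uw]. *)
transitivity ((- (m + q) ^+ 2) * ((S ^+ 2 - Q) / 2 + m * a * b)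
  + ((m + p) * a + (m + q) * b)
    * (q * (q - 1) / 2 * ((m + q) * b - (m + p) * a)
       + (p * q + m) * a * (m + q))).
  by rewrite SE QE /split_cubic /split_center; field.
by rewrite G0 uw; ring.
Qed.

(** With the values m + q on [P] and - (m + p) off [P], the two sides of every equation differ by
    minus the cubic. The values add up to q - p, so they are not both 0, and both occur because [P]
    is neither empty nor full. *)
Lemma complete_eigen3_split (n : nat) (P : {set 'I_n}) (m : K) :
  (0 < #|P| < n)%N -> #|P|%:R != n%:R - #|P|%:R :> K ->
  split_cubic #|P|%:R (n%:R - #|P|%:R) m = 0 ->
  hyper_eigenvalue (adjacency K (complete_hypergraph 3 n)) (m + 1).
Proof.
move=> /andP[P0 Pn]; set p : K := #|P|%:R; set q : K := n%:R - p => pq mE.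
apply/complete_eigen3.
(* The solution, up to scaling, of [(m + p) * a + (m + q) * b = 0]. It vanishes
   only for [p = q], which is why that case is excluded. *)
pose a := m + q; pose b := - (m + p).
pose v : 'rV[K]_n := \row_j if j \in P then a else b; exists v; split.
  have [i iP] : exists i, i \in P by apply/set0Pn; rewrite -card_gt0.
  have [j jP] : exists j, j \in ~: P.
    apply/set0Pn; apply: contraTneq Pn => P'0.
    by have := cardsC P; rewrite P'0 cards0 addn0 card_ord => ->; rewrite ltnn.
  rewrite inE in jP.
  have [a0|a0] := eqVneq a 0; last first.
    by apply/rV0Pn; exists i; rewrite mxE iP.
  apply/rV0Pn; exists j; rewrite mxE (negbTE jP).
  have -> : b = q - p - a by rewrite /b /a; ring.
  by rewrite a0 subr0 subr_eq0 eq_sym.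
have SE : \sum_j v 0 j = a * p + b * q.
  by rewrite -sum_two_valued; apply: eq_bigr => i _; rewrite mxE.
have QE : \sum_j v 0 j ^+ 2 = a ^+ 2 * p + b ^+ 2 * q.
  rewrite -sum_two_valued; apply: eq_bigr => i _; rewrite mxE.
  by case: ifP.
move=> i; rewrite SE QE; apply/eqP; rewrite -subr_eq0; apply/eqP.
transitivity (- split_cubic p q m); last by rewrite mE oppr0.
by rewrite mxE; case: ifP => _; rewrite /a /b /split_cubic /split_center; field.
Qed.

(** The constant vector has eigenvalue (n - 1) (n - 2) / 2; this covers the empty and full [P], left
    out by [complete_eigen3_split]. *)
Lemma complete_eigen3_const (n : nat) : (0 < n)%N ->
  hyper_eigenvalue (adjacency K (complete_hypergraph 3 n))
    (split_center n%:R 0 + 1).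
Proof.
move=> n0; apply/complete_eigen3; exists (\row_j 1); split.
  by apply/rV0Pn; exists (Ordinal n0); rewrite mxE oner_eq0.
move=> i; under eq_bigr do rewrite mxE.
under [X in _ - (X - _)]eq_bigr do rewrite mxE expr1n.
by rewrite sumr_const card_ord mxE /split_center; field.
Qed.

End Eigen.

Arguments split_center {K} p q.
Arguments split_cubic {K} p q m.

(** For eigenvalue 1 the quadratic terms cancel, so any nonzero vector with S = Q = 0 will do: here
    the fourth roots of unity, padded with zeros. This gives the eigenvalue 0 of J / 2 a
    neighbour. *)
Lemma complete_eigen3_1 (K : numClosedFieldType) (n : nat) : (3 < n)%N ->
  hyper_eigenvalue (adjacency K (complete_hypergraph 3 n)) 1.
Proof.
move=> n3; apply/complete_eigen3.
pose s : seq K := [:: 1; 'i; -1; - 'i].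
exists (\row_j s`_j); split.
  by apply/rV0Pn; exists (Ordinal (ltnW (ltnW (ltnW n3))));
    rewrite mxE oner_eq0.
have S0 : \sum_(j < n) s`_j = 0.
  by rewrite big_ord_nth // !big_cons big_nil; ring.
have Q0 : \sum_(j < n) s`_j ^+ 2 = 0.
  transitivity (\sum_(j < n) [seq x ^+ 2 | x <- s]`_j).
    apply: eq_bigr => j _; have [js|js] := ltnP j (size s).
      by rewrite (nth_map 0).
    by rewrite !nth_default ?size_map // expr0n.
  rewrite big_ord_nth // !big_cons big_nil !sqrrN sqrCi expr1n; ring.
move=> i; under eq_bigr do rewrite mxE.
under [X in _ - (X - _)]eq_bigr do rewrite mxE.
by rewrite S0 Q0 mxE; field.
Qed.

Local Open Scope complex_scope.

(** * Norms and distances in [R[i]], and the location of the roots of the cubic *)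

Section Distance.
Variable R : realType.
Local Notation C := R[i].

(** The norm of [R[i]] takes values in [R[i]], which is only partially ordered; its real part lives
    in the totally ordered [R]. *)
Definition cnorm (z : C) : R := complex.Re `|z|.

Lemma cnormE (z : C) : `|z| = (cnorm z)%:C.
Proof. by rewrite /cnorm normc_def. Qed.

Lemma cnorm_real (x : R) : cnorm x%:C = `|x|.
Proof. by apply: complexI; rewrite -cnormE normc_def /= expr0n addr0 sqrtr_sqr. Qed.

Lemma cnorm_ge0 (z : C) : 0 <= cnorm z.
Proof. by rewrite -lecR -cnormE rmorph0 normr_ge0. Qed.

Lemma cnormM (x y : C) : cnorm (x * y) = cnorm x * cnorm y.
Proof. by apply: complexI; rewrite rmorphM -!cnormE normrM. Qed.

Lemma cnormN (z : C) : cnorm (- z) = cnorm z.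
Proof. by rewrite /cnorm normrN. Qed.

Lemma cnormD (x y : C) : cnorm (x + y) <= cnorm x + cnorm y.
Proof. by rewrite -lecR rmorphD -!cnormE ler_normD. Qed.

Lemma cnorm1 : cnorm 1 = 1.
Proof. by rewrite -[1]/(1%:C) cnorm_real normr1. Qed.

Lemma thickeningP (r : R) (S : set C) (w z : C) :
  S z -> cnorm (z - w) < r -> thickening r S w.
Proof. by move=> Sz zw; exists z => //; rewrite /cdisk /= cnormE ltcR. Qed.

(** A point of [A] lies in some disc of each admissible radius, so that radius is nonnegative; for
    two empty sets the infimum would be -oo. *)
Lemma minkowski_dist_bounds (A B : set C) (r : R) : (A !=set0)%classic ->
  (A `<=` thickening r B)%classic -> (B `<=` thickening r A)%classic ->
  (0 <= minkowski_dist A B <= r%:E)%E.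
Proof.
move=> [a Aa] AB BA; apply/andP; split; last first.
  by apply: ereal_inf_lbound; exists r.
apply: le_ereal_inf_tmp => _ [s [As _] <-]; rewrite lee_fin.
have [b _] := As _ Aa; rewrite /cdisk /= cnormE ltcR => /ltW.
exact/le_trans/cnorm_ge0.
Qed.

Lemma split_centerC (p q : R) :
  (split_center p q)%:C = split_center p%:C q%:C.
Proof.
rewrite /split_center.
by rewrite rmorphM rmorphB rmorphXn rmorphB rmorphM (rmorphD _ p) fmorphV !rmorph_nat.
Qed.

Lemma split_squareC (p q : R) :
  ((p - q) ^+ 2 / 2)%:C = (p%:C - q%:C) ^+ 2 / 2.
Proof. by rewrite rmorphM rmorphXn rmorphB fmorphV rmorph_nat. Qed.

Lemma mulr_le_sqr_sum (p q : R) : p * q <= (p + q) ^+ 2 / 4.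
Proof. by have := sqr_ge0 (p - q); nra. Qed.

(** At a root, |m|^2 |m - d| = |3 p q m + p q n / 2|. If both distances were at least e n^2, hence
    at least 3 n, the left side would be at least 9 n^2 |m|, while p q <= n^2 / 4 keeps the right
    side below n^2 |m|. *)
Lemma split_cubic_root_near (p q e : R) (m : C) : 0 <= p -> 0 <= q ->
  3 <= e * (p + q) -> split_cubic p%:C q%:C m = 0 ->
  cnorm m < e * (p + q) ^+ 2 \/
  cnorm (m - (split_center p q)%:C) < e * (p + q) ^+ 2.
Proof.
move=> p0 q0; set n := p + q => en m0.
have n0 : 0 < n.
  have : 0 <= n by rewrite addr_ge0.
  by rewrite le_eqVlt => /predU1P[E|//]; move: en; rewrite -E; lra.
set a := cnorm m; set b := cnorm _.
have ab : a ^+ 2 * b <= 3 * (p * q) * a + p * q * n / 2.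
  have -> : a ^+ 2 * b =
      cnorm ((3 * (p * q))%:C * m + (p * q * n / 2)%:C).
    rewrite expr2 -!cnormM -cnormN; congr cnorm.
    apply/eqP; rewrite -subr_eq0 -oppr_eq0; apply/eqP.
    rewrite -[RHS]m0 /split_cubic /n split_centerC.
    by rewrite !(rmorphM, rmorphD, fmorphV, rmorph_nat); ring.
  apply: le_trans (cnormD _ _) _.
  rewrite cnormM !cnorm_real !ger0_norm //;
    by rewrite ?divr_ge0 ?mulr_ge0 // ltW.
have [an|an] := ltP a (e * n ^+ 2); [by left | right].
have [//|bn] := ltP b (e * n ^+ 2); exfalso.
have en2 : 3 * n <= e * n ^+ 2 by rewrite expr2 mulrA ler_pM2r.
have a3 : 3 * n <= a := le_trans en2 an.
have b3 : 3 * n <= b := le_trans en2 bn.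
have a0 : 0 < a by nra.
have ab9 : 9 * n ^+ 2 * a <= a ^+ 2 * b.
  have -> : a ^+ 2 * b = a * b * a by ring.
  rewrite ler_pM2r //.
  have -> : 9 * n ^+ 2 = 3 * n * (3 * n) by ring.
  by rewrite ler_pM // mulr_ge0 // ltW.
have pq := mulr_le_sqr_sum p q; rewrite -/n in pq.
have pq1 : p * q * a <= n ^+ 2 / 4 * a by rewrite ler_pM2r.
have pq2 : p * q * n <= n ^+ 2 / 4 * n by rewrite ler_pM2r.
have n2a : n ^+ 2 * (3 * n) <= n ^+ 2 * a by rewrite ler_pM2l // exprn_gt0.
have n2a0 : 0 < n ^+ 2 * a by rewrite mulr_gt0 // exprn_gt0.
lra.
Qed.

End Distance.

Arguments cnorm {R} z.

(** |P(x)| is the product of the distances from [x] to the roots, so they cannot all be at least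
    [r]. *)
Lemma monic_root_near (K : numClosedFieldType) (P : {poly K}) (x r : K) :
  P \is monic -> 0 <= r -> `|P.[x]| < r ^+ (size P).-1 ->
  exists2 z, root P z & `|x - z| < r.
Proof.
move=> Pm r0; have [s Ps] := closed_field_poly_normal P.
rewrite (monicP Pm) scale1r in Ps; rewrite Ps size_prod_XsubC /=.
rewrite horner_prod normr_prod => lt_r.
suff /hasP[z zs xz] : has (fun z => `|x - z| < r) s.
  by exists z; rewrite ?root_prod_XsubC.
apply: contraTT lt_r => /hasPn far.
rewrite -real_leNgt ?ger0_real ?exprn_ge0 ?prodr_ge0 //.
elim: s {Ps} far => [|z s IH] far; first by rewrite big_nil expr0.
rewrite big_cons exprS hornerXsubC ler_pM ?exprn_ge0 //.
  by rewrite real_leNgt ?ger0_real //; apply: far; rewrite mem_head.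
by apply: IH => y ys; apply: far; rewrite inE ys orbT.
Qed.

Lemma split_cubic_root_exists (R : realType) (p q e : R) :
  0 <= p -> 0 <= q -> 3 <= p + q -> 0 < e ->
  3 <= e * (p + q) -> 3 <= e ^+ 2 * (p + q) ->
  exists2 m : R[i], split_cubic p%:C q%:C m = 0 &
    cnorm ((split_center p q)%:C - m) < e * (p + q) ^+ 2.
Proof.
move=> p0 q0; set n := p + q => n3 e0 en e2n.
have n0 : 0 < n by lra.
set d := split_center p q; set f := 3 * (p * q) * d + p * q * n / 2.
pose g : {poly R[i]} := \poly_(i < 3)
  [:: p%:C * q%:C * (p%:C + q%:C) / 2; 3 * p%:C * q%:C; - d%:C]`_i.
have gs : (size g < size ('X^3 : {poly R[i]}))%N.
  by rewrite size_polyXn ltnS size_poly.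
have hP x : ('X^3 + g).[x] = split_cubic p%:C q%:C x.
  rewrite hornerD hornerXn horner_poly !big_ord_recr big_ord0 /=.
  by rewrite /split_cubic -split_centerC -/d; ring.
have gm : 'X^3 + g \is monic by rewrite monicE lead_coefDl // lead_coefXn.
have fd : split_cubic p%:C q%:C d%:C = f%:C.
  rewrite /split_cubic -split_centerC -/d /f /n.
  by rewrite !(rmorphM, rmorphD, fmorphV, rmorph_nat); ring.
have pq0 : 0 <= p * q by rewrite mulr_ge0.
have pq := mulr_le_sqr_sum _ p q; rewrite -/n in pq.
have n2 : 3 * n <= n ^+ 2 by rewrite expr2 ler_pM2r.
have dn : `|d| <= n ^+ 2 / 2.
  have pqn : (p - q) ^+ 2 = n ^+ 2 - 4 * (p * q) by rewrite /n; ring.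
  have := sqr_ge0 (p - q).
  by rewrite /d /split_center -/n pqn ler_norml => h; apply/andP; split; lra.
(* Here |f| <= 3 (n^2 / 4) (n^2 / 2) + n^3 / 8 <= n^4, and (e n^2)^3 is n^4 times (e^2 n) (e n), a
   factor of at least 9. *)
have fn : `|f| < (e * n ^+ 2) ^+ 3.
  apply: (@le_lt_trans _ _ (n ^+ 4)).
    apply: le_trans (ler_normD _ _) _.
    rewrite normrM (ger0_norm (_ : 0 <= 3 * (p * q))) ?mulr_ge0 //.
    have n0W := ltW n0.
    rewrite (ger0_norm (_ : 0 <= p * q * n / 2)) ?divr_ge0 ?mulr_ge0 //.
    have h1 : p * q * `|d| <= n ^+ 2 / 4 * (n ^+ 2 / 2) by rewrite ler_pM.
    have h2 : p * q * n <= n ^+ 2 / 4 * n by rewrite ler_pM2r.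
    have h3 : n ^+ 2 * (3 * n) <= n ^+ 2 * n ^+ 2.
      by rewrite ler_pM2l // exprn_gt0.
    have h4 : 0 < n ^+ 2 * n ^+ 2 by rewrite mulr_gt0 // exprn_gt0.
    have -> : n ^+ 4 = n ^+ 2 * n ^+ 2 by rewrite -exprD.
    lra.
  have -> : (e * n ^+ 2) ^+ 3 = e ^+ 2 * n * (e * n) * n ^+ 4 by ring.
  rewrite ltr_pMl ?exprn_gt0 //.
  have : 3 * 3 <= e ^+ 2 * n * (e * n) by rewrite ler_pM.
  lra.
have [] := @monic_root_near _ ('X^3 + g) d%:C (e * n ^+ 2)%:C gm.
- by rewrite -[0]/(0%:C) lecR mulr_ge0 ?exprn_ge0 // ltW.
- rewrite hP fd cnormE cnorm_real size_addl // size_polyXn /=.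
  by rewrite -rmorphXn ltcR.
move=> m /rootP; rewrite hP => m0; rewrite cnormE ltcR => md.
by exists m.
Qed.

(** * Comparison of the two spectra *)

Section Closeness.
Variable R : realType.

(** One e n^2 bounds the distance from a root of the cubic to 0 or to its center; the other absorbs
    the shifts 1 and 3 n / 2 - 1, as 3 n <= e n^2. *)
Lemma spectra3_close (n : nat) (e : R) : (3 < n)%N -> 0 < e ->
  3 <= e * n%:R -> 3 <= e ^+ 2 * n%:R ->
  (all_ones_spectrum R 3 n
     `<=` thickening (2 * e * n%:R ^+ 2) (complete_spectrum R 3 n))%classic /\
  (complete_spectrum R 3 n
     `<=` thickening (2 * e * n%:R ^+ 2) (all_ones_spectrum R 3 n))%classic.
Proof.
move=> n3 e0 en e2n.
have n4 : 4 <= n%:R :> R by rewrite ler_nat.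
have en2 : 3 * n%:R <= e * n%:R ^+ 2.
  by rewrite expr2 mulrA ler_pM2r //; lra.
have splitC (P : {set 'I_n}) :
    n%:R - #|P|%:R = (n%:R - #|P|%:R : R)%:C :> R[i].
  by rewrite rmorphB !rmorph_nat.
have Pn (P : {set 'I_n}) : #|P|%:R <= n%:R :> R.
  by rewrite ler_nat -[leqRHS]card_ord max_card.
split=> l.
  have close0 : thickening (2 * e * n%:R ^+ 2) (complete_spectrum R 3 n) 0.
    apply: (@thickeningP _ _ _ _ 1); first exact: complete_eigen3_1.
    by rewrite subr0 cnorm1; lra.
  move=> /all_ones_eigen3_inv[->//|[P ->]].
  set p : R := #|P|%:R; set q : R := n%:R - p.
  have pE : #|P|%:R = p%:C by rewrite rmorph_nat.
  have pqn : p + q = n%:R by rewrite addrC subrK.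
  have p0 : 0 <= p by exact: ler0n.
  have q0 : 0 <= q by rewrite subr_ge0 Pn.
  rewrite splitC pE -/p -/q.
  rewrite -split_squareC.
  (* For p = q the eigenvalue is 0, whose neighbour is already known. *)
  have [->|pq] := eqVneq p q; first by rewrite subrr expr0n mul0r.
  have [P0n|] := boolP (0 < #|P| < n)%N; last first.
    move=> P0n.
    (* [P] is empty or full: the eigenvalue n^2 / 2 is matched with that of the constant vector, at
       distance 3 n / 2 - 1. *)
    have -> : (p - q) ^+ 2 = n%:R ^+ 2.
      move: P0n; rewrite negb_and -leqNgt leqn0 -leqNgt => /orP[/eqP P0|nP].
        by rewrite /q /p P0 subr0 sub0r sqrrN.
      by rewrite /q (_ : p = n%:R) ?subrr ?subr0 //; apply: le_anti;
        rewrite Pn ler_nat.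
    apply: (@thickeningP _ _ _ _ (split_center n%:R 0 + 1)).
      by apply: complete_eigen3_const; apply: ltnW (ltnW (ltnW _)).
    have -> : split_center n%:R 0 + 1 - (n%:R ^+ 2 / 2)%:C =
        (split_center n%:R 0 + 1 - n%:R ^+ 2 / 2)%:C :> R[i].
      have -> : split_center n%:R 0 = (split_center n%:R 0)%:C :> R[i].
        by rewrite split_centerC rmorph_nat rmorph0.
      by rewrite [in RHS]rmorphB rmorphD rmorph1.
    rewrite cnorm_real /split_center subr0 addr0.
    by rewrite ltr_norml; apply/andP; split; lra.
  have [] := @split_cubic_root_exists _ p q e; rewrite ?pqn //.
    lra.
  move=> m m0 dm.
  apply: (@thickeningP _ _ _ _ (m + 1)).
    apply: (@complete_eigen3_split _ _ P) => //; rewrite splitC pE //.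
    by rewrite (inj_eq (@complexI R)).
  rewrite -cnormN.
  have -> : - (m + 1 - ((p - q) ^+ 2 / 2)%:C) =
      ((split_center p q)%:C - m) + (3 * n%:R / 2 - 1)%:C.
    have -> : (p - q) ^+ 2 / 2 = split_center p q + 3 * n%:R / 2.
      by rewrite /split_center pqn; field.
    by rewrite [in LHS]rmorphD rmorphB rmorph1; ring.
  apply: le_lt_trans (cnormD _ _ _) _; rewrite cnorm_real ger0_norm; lra.
(* Handles both the eigenvalue 1, where [m] is 0, and the roots of the cubic near 0. *)
have close0 (m : R[i]) : cnorm m < e * n%:R ^+ 2 ->
    thickening (2 * e * n%:R ^+ 2) (all_ones_spectrum R 3 n) (m + 1).
  move=> mn; apply: (@thickeningP _ _ _ _ 0).
    by apply: all_ones_eigen3_0; apply: ltnW (ltnW _).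
  rewrite sub0r cnormN; apply: le_lt_trans (cnormD _ _ _) _.
  by rewrite cnorm1; lra.
rewrite -[l](subrK 1); move: (l - 1) => m.
move=> /complete_eigen3_inv; rewrite addrK => -[E|[P]].
  apply: close0; have -> : m = 0%:C by apply: (addIr 1); rewrite E add0r.
  by rewrite cnorm_real normr0; lra.
set p : R := #|P|%:R; set q : R := n%:R - p.
have pE : #|P|%:R = p%:C by rewrite rmorph_nat.
have pqn : p + q = n%:R by rewrite addrC subrK.
have p0 : 0 <= p by exact: ler0n.
have q0 : 0 <= q by rewrite subr_ge0 Pn.
rewrite splitC pE -/p -/q => m0.
have [] := @split_cubic_root_near _ p q e m; rewrite ?pqn //.
  exact: close0.
move=> md.
apply: (@thickeningP _ _ _ _ ((p - q) ^+ 2 / 2)%:C).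
  rewrite split_squareC -pE -splitC.
  by apply: all_ones_eigen3_split; apply: ltnW (ltnW (ltnW _)).
have -> : ((p - q) ^+ 2 / 2)%:C - (m + 1) =
    (3 * n%:R / 2 - 1)%:C - (m - (split_center p q)%:C).
  have -> : (p - q) ^+ 2 / 2 = split_center p q + 3 * n%:R / 2.
    by rewrite /split_center pqn; field.
  by rewrite [in LHS]rmorphD rmorphB rmorph1; ring.
apply: le_lt_trans (cnormD _ _ _) _; rewrite cnormN cnorm_real ger0_norm; lra.
Qed.

(** Translation by 1 moves each point by exactly 1, and the discs are open, whence the strict
    bound. *)
Lemma spectra2_close (n : nat) (r : R) : 1 < r ->
  (all_ones_spectrum R 2 n `<=` thickening r (complete_spectrum R 2 n))%classic /\
  (complete_spectrum R 2 n `<=` thickening r (all_ones_spectrum R 2 n))%classic.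
Proof.
move=> r1; split=> l lE.
  apply: (@thickeningP _ _ _ _ (l - 1)).
    by apply/all_ones_eigen2_shift; rewrite subrK.
  by rewrite addrAC subrr sub0r cnormN cnorm1.
apply: (@thickeningP _ _ _ _ (l + 1)); first exact/all_ones_eigen2_shift.
by rewrite addrAC subrr add0r cnorm1.
Qed.

Local Open Scope classical_set_scope.

Lemma spectra_dist_small (k : nat) (e : R) : k = 2%N \/ k = 3%N -> 0 < e ->
  \forall n \near \oo,
    (0 <= minkowski_dist (all_ones_spectrum R k n) (complete_spectrum R k n)
       <= (e * n%:R ^+ k.-1)%:E)%E.
Proof.
move=> hk e0; near=> n.
have n3 : (3 < n)%N by near: n; apply: nbhs_infty_ge.
have n0 : 0 < n%:R :> R by rewrite ltr0n; apply: ltnW (ltnW (ltnW _)).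
(* The constants 6 and 12 become 3 and 3 once [e] is halved for [spectra3_close]; for k = 2 the
   bound exceeds the required 1. *)
have en : 6 <= e * n%:R.
  rewrite -ler_pdivrMl // mulrC; near: n; exact: nbhs_infty_ger.
have e2n : 12 <= e ^+ 2 * n%:R.
  rewrite -ler_pdivrMl ?exprn_gt0 // mulrC; near: n; exact: nbhs_infty_ger.
case: hk => ->.
  have [] := @spectra2_close n (e * n%:R ^+ 1); first by rewrite expr1; lra.
  apply: minkowski_dist_bounds; exists 0; apply: all_ones_eigen2_0.
  exact: ltnW (ltnW _).
have -> : e * n%:R ^+ 2 = 2 * (e / 2) * n%:R ^+ 2 by field.
have [||| MN NM] := @spectra3_close n (e / 2) n3; [lra | lra | |].
  have -> : (e / 2) ^+ 2 * n%:R = e ^+ 2 * n%:R / 4 by field.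
  by lra.
apply: minkowski_dist_bounds MN NM; exists 0; apply: all_ones_eigen3_0.
exact: ltnW (ltnW _).
Unshelve. all: by end_near.
Qed.

End Closeness.

Local Open Scope classical_set_scope.

Theorem theorem3 (R : realType) (k : nat) (hk : k = 2%N \/ k = 3%N) :
  (\forall n \near \oo,
     minkowski_dist (all_ones_spectrum R k n) (complete_spectrum R k n)
       \is a fin_num) /\
  (fun n : nat =>
     fine (minkowski_dist (all_ones_spectrum R k n) (complete_spectrum R k n)))
  =o_\oo (fun n : nat => n%:R ^+ k.-1 : R).
Proof.
split.
  (* The bound with e = 1 already gives finiteness. *)
  apply: filterS (spectra_dist_small R _ _ hk ltr01) => n /andP[d0 dn].
  by rewrite ge0_fin_numE //; apply: le_lt_trans dn (ltry _).
apply/eqoP => e e0.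
apply: filterS (spectra_dist_small R _ _ hk e0) => n /andP[d0 dn].
rewrite ger0_norm ?fine_ge0 // ger0_norm ?exprn_ge0 //.
by rewrite -lee_fin fineK // ge0_fin_numE //; apply: le_lt_trans dn (ltry _).
Qed.
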